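(* Let $n\ge 2$ be an integer and let $T_{4n}=\langle x,y : x^{2n}=1,\ x^n=y^2,\ y^{-1}xy=x^{-1}\rangle$ be the dicyclic group of order $4n$. Then the CN-spectrum and CN-energy of its commuting conjugacy class graph are $$\text{CN-spec}(\Gamma(T_{4n}))=\{(-(n-3))^{(n-2)},\ ((n-2)(n-3))^1,\ 0^2\}$$ and $$E_{CN}(\Gamma(T_{4n}))=2(n-2)(n-3).$$
   Context: For a finite non-abelian group $G$, the commuting conjugacy class graph $\Gamma(G)$ is the simple undirected graph whose vertices are the conjugacy classes of the non-central elements of $G$; two distinct vertices $a^G$ and $b^G$ are adjacent if there exist $a'\in a^G$, $b'\in b^G$ with $a'b'=b'a'$. For a finite simple graph $\mathcal{G}$ with vertices $v_1,\dots,v_N$, the common neighbourhood matrix $CN(\mathcal{G})$ is the $N\times N$ matrix whose $(i,j)$ entry is, for $i\ne j$, the number of vertices other than $v_i,v_j$ adjacent to both $v_i$ and $v_j$, and is $0$ for $i=j$. The CN-spectrum $\text{CN-spec}(\mathcal{G})$ is the multiset of eigenvalues of $CN(\mathcal{G})$; writing $\{\lambda_1^{\alpha_1},\dots,\lambda_k^{\alpha_k}\}$ means that $\lambda_i$ is listed $\alpha_i$ times (multiplicities of coinciding values add up; entries with exponent $0$ are absent). The CN-energy $E_{CN}(\mathcal{G})$ is the sum of the absolute values of the eigenvalues of $CN(\mathcal{G})$, counted with multiplicity. *)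

(* Defs.v *)
From mathcomp Require Import all_boot all_order all_algebra.
From mathcomp Require Import all_fingroup all_solvable all_field.

Set Implicit Arguments.
Unset Strict Implicit.
Unset Printing Implicit Defensive.

Import Order.TTheory GRing.Theory Num.Theory.

Record sgraph := SGraph {
  vertex :> finType;
  adj : rel vertex;
  adj_sym : symmetric adj;
  adj_irrefl : irreflexive adj
}.

Section CommonNeighbourhood.

Variable G : sgraph.

Definition common_neighbours (u v : G) : {set G} :=
  [set w | [&& w != u, w != v, adj w u & adj w v]].

(* The vertices are numbered by [enum_val]; another numbering conjugates the
   matrix by a permutation matrix. *)
Definition CN_matrix : 'M[algC]_#|G| :=
  (\matrix_(i, j)
     if i == j then 0
     else #|common_neighbours (enum_val i) (enum_val j)|%:R)%R.

End CommonNeighbourhood.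

(* The eigenvalues in [algC], repeated according to algebraic multiplicity:
   the sequence of roots of the (monic, split) characteristic polynomial. Only
   its class modulo [perm_eq] is meaningful. *)
Definition spectrum (m : nat) (A : 'M[algC]_m) : seq algC :=
  sval (closed_field_poly_normal (char_poly A)).

Definition CN_spec (G : sgraph) : seq algC := spectrum (CN_matrix G).

Definition CN_energy (G : sgraph) : algC := (\sum_(z <- CN_spec G) `|z|)%R.

Section CommutingConjugacyClassGraph.

Local Open Scope group_scope.

Variables (gT : finGroupType) (G : {group gT}).

Definition noncentral_classes : {set {set gT}} :=
  [set a ^: G | a in G :\: 'Z(G)].

Definition ccc_vertex : finType := {C : {set gT} | C \in noncentral_classes}.

Definition ccc_adj (C D : ccc_vertex) : bool :=
  (C != D) && [exists a in val C, exists b in val D, a * b == b * a].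

Lemma ccc_adj_sym : symmetric ccc_adj.
Proof.
move=> C D; rewrite /ccc_adj eq_sym; congr (_ && _).
by apply/exists_inP/exists_inP => -[a aX /exists_inP[b bY /eqP ab]];
  exists b => //; apply/exists_inP; exists a => //; rewrite ab.
Qed.

Lemma ccc_adj_irrefl : irreflexive ccc_adj.
Proof. by move=> C; rewrite /ccc_adj eqxx. Qed.

Definition ccc_graph : sgraph := SGraph ccc_adj_sym ccc_adj_irrefl.

End CommutingConjugacyClassGraph.

(* Main.v *)
Require Import Defs.
From mathcomp Require Import all_boot all_order all_algebra.
From mathcomp Require Import all_fingroup all_solvable all_field.
From mathcomp Require Import ring.

(** The cyclic subgroup H = <x> has order 2n and index 2 in T_4n, and every
    element outside H inverts H by conjugation.  Only this, together with the
    fact that H has exactly two solutions of h^2 = 1, is used to find the graph.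
    These two solutions form the centre.  A non-central h in H has class
    {h, h^-1}, so H carries n - 1 vertices, pairwise adjacent because H is
    abelian.  An element g outside H centralises only the two solutions of
    h^2 = 1 in H, so it is not adjacent to any class in H, and its class has n
    elements; hence the 2n elements outside H form just two classes
    ([inverted_half_classes]).  So the graph is a complete graph K_(n-1) plus
    two further vertices, which are adjacent to each other or not according to
    the parity of n.

    That parity does not matter for common neighbourhoods: a component with at
    most two vertices gives no common neighbours.  With k = n - 2, the matrix
    is (k - 1)(J - I) on the clique and 0 elsewhere; a bordered determinant
    gives its characteristic polynomial ([char_poly_scaled_clique]), whence the
    spectrum ([CN_spec_isolated_clique]).

    The presentation yields generators satisfying the relations, hence
    #|G| <= 4n, but the reverse inequality, without which H could be smaller,
    needs a group of order at least 4n where the relations hold.  The right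
    regular representation on the normal forms x^i y^b provides one
    ([dicyclic_model_homg], [dicyclic_model_card]). *)

Set Implicit Arguments.
Unset Strict Implicit.
Unset Printing Implicit Defensive.

Import Order.TTheory GRing.Theory Num.Theory.

Local Open Scope ring_scope.

(** * Spectrum of a clique beside at most two other vertices *)

(** Such an A is c(J - I) on the index set S and 0 elsewhere, so 'X - A is a
    diagonal matrix D minus a rank-one matrix u v.  The bordered matrix
    M = [D, u; v, 1] has determinant det (D - u v).  Since v D = ('X + c) v, the
    row operation (-v, 'X + c) clears the lower left block of M, giving
    ('X + c) det M = det D * ('X + c - v u) without inverting D. *)
Lemma char_poly_scaled_clique (R : idomainType) (m k : nat) (S : {set 'I_m})
    (c : R) (A : 'M[R]_m) :
    #|S| = k.+1 ->
    (forall i j, A i j = if i == j then 0 else c *+ ((i \in S) && (j \in S))) ->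
  char_poly A = ('X + c%:P) ^+ k * ('X - (c *+ k)%:P) * 'X ^+ #|~: S|.
Proof.
move=> cardS defA; pose Xc : {poly R} := 'X + c%:P.
pose d : 'rV[{poly R}]_m := \row_i if i \in S then Xc else 'X.
pose u : 'cV[{poly R}]_m := \col_i (c *+ (i \in S))%:P.
pose v : 'rV[{poly R}]_m := \row_j (j \in S)%:R.
have charA : char_poly_mx A = diag_mx d - u *m v.
  apply/matrixP=> i j; rewrite !mxE big_ord1 !mxE defA.
  case: (eqVneq i j) => [<-|_]; last first.
    by rewrite !mulr0n !sub0r; case: (i \in S); case: (j \in S);
      rewrite ?mulr1 ?mulr0 ?mulr1n ?mulr0n.
  by rewrite !mulr1n subr0; case: (i \in S); rewrite ?mulr1 ?mulr0 ?mulr1n /Xc;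
    rewrite ?addrK ?subr0.
have vd : v *m diag_mx d = Xc *: v.
  apply/matrixP=> i j; rewrite mul_mx_diag !mxE.
  by case: (j \in S); rewrite ?mul1r ?mulr1 ?mul0r ?mulr0.
have vu : v *m u = (c *+ k.+1)%:P%:M.
  apply/matrixP=> i j; rewrite !ord1 !mxE mulr1n -cardS.
  under eq_bigr do rewrite !mxE.
  rewrite (bigID [in S]) /= [X in _ + X]big1 => [|l /negPf->];
    last by rewrite mul0r.
  rewrite addr0; under eq_bigr => l -> do rewrite mul1r mulr1n.
  by rewrite sumr_const rmorphMn.
have detd : \prod_i d 0 i = Xc ^+ k.+1 * 'X ^+ #|~: S|.
  under eq_bigr do rewrite mxE.
  rewrite (bigID [in S]) /= -cardS -!prodr_const; congr (_ * _).
    by apply: eq_bigr => i ->.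
  by apply: eq_big => [i|i /negPf->]; rewrite ?inE.
pose M := block_mx (diag_mx d) u v 1%:M.
have detM : \det M = char_poly A.
  have: \det (M *m block_mx 1%:M 0 (- v) 1%:M) = char_poly A.
    rewrite mulmx_block !mulmx0 !mulmx1 !add0r mul1mx addrN mulmxN.
    by rewrite det_ublock det1 mulr1 -charA.
  by rewrite det_mulmx det_lblock !det1 !mulr1.
have Xc0 : Xc != 0 by rewrite monic_neq0 // monicXaddC.
apply: (mulfI Xc0); rewrite -detM.
have: \det (block_mx 1%:M 0 (- v) Xc%:M *m M) = Xc * \det M.
  by rewrite det_mulmx det_lblock det1 mul1r det_scalar1.
rewrite mulmx_block !mul1mx !mul0mx !addr0 !mulNmx vd vu !mulmx1.
rewrite mul_scalar_mx addNr det_ublock det_diag detd => <-.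
rewrite det_mx11 !mxE !mulr1n exprS /Xc mulrS polyCD.
by ring.
Qed.

Lemma perm_spectrum (m : nat) (A : 'M[algC]_m) (s : seq algC) :
  char_poly A = \prod_(z <- s) ('X - z%:P) -> perm_eq (spectrum A) s.
Proof.
rewrite /spectrum; case: closed_field_poly_normal => r /= -> charA.
apply: prod_XsubC_eq; rewrite -charA.
by rewrite (monicP (char_poly_monic A)) scale1r.
Qed.

Lemma card_common_neighbours_clique (G : sgraph) (S : {set G}) (u v : G) :
    {in S &, forall x y, adj x y = (x != y)} ->
    u \in S -> v \in S -> u != v ->
    {in S, forall x y, y \notin S -> ~~ adj x y} ->
  #|common_neighbours u v| = (#|S| - 2)%N.
Proof.
move=> cliqueS uS vS uv isoS.
rewrite (cardsD1 u S) (cardsD1 v (S :\ u)) uS !inE [v == u]eq_sym.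
rewrite uv vS /= addnA addKn.
apply: eq_card => w; rewrite !inE; case: (boolP (w \in S)) => wS.
  by rewrite !cliqueS //; case: (w == u); case: (w == v).
by rewrite [adj w u]adj_sym (negPf (isoS _ uS _ wS)) !andbF.
Qed.

(** Off the clique there are too few vertices for a pair to have a common
    neighbour, so edges between those vertices do not affect the spectrum. *)
Lemma CN_spec_isolated_clique (G : sgraph) (S : {set G}) (k : nat) :
    #|S| = k.+1 -> (#|~: S| <= 2)%N ->
    {in S &, forall x y, adj x y = (x != y)} ->
    {in S, forall x y, y \notin S -> ~~ adj x y} ->
  perm_eq (CN_spec G)
    (nseq k (1 - k%:R) ++ (k%:R * (k%:R - 1)) :: nseq #|~: S| 0).
Proof.
move=> cardS cardCS cliqueS isoS; apply: perm_spectrum.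
pose I := [set i : 'I_#|G| | enum_val i \in S].
have card_preim (B : {set G}) : #|[set i : 'I_#|G| | enum_val i \in B]| = #|B|.
  rewrite -(card_imset _ enum_val_inj); apply: eq_card => x.
  apply/imsetP/idP => [[i]|xB]; first by rewrite inE => ? ->.
  by exists (enum_rank x); rewrite ?inE enum_rankK.
have cardI : #|I| = k.+1 by rewrite card_preim.
have cardCI : #|~: I| = #|~: S|.
  by rewrite -card_preim; apply: eq_card => i; rewrite !inE.
rewrite (char_poly_scaled_clique (c := k%:R - 1) cardI) => [|i j].
  have prod_nseq z l :
      \prod_(x <- nseq l z) ('X - x%:P) = ('X - z%:P : {poly algC}) ^+ l.
    by rewrite big_nseq iter_mulr_1.
  rewrite big_cat big_cons !prod_nseq /= cardCI subr0 mulrA.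
  by rewrite -[(k%:R - 1) *+ k]mulr_natl -(opprB k%:R 1) polyCN opprK.
rewrite mxE; case: eqVneq => // ij.
have uv : enum_val i != enum_val j by rewrite (inj_eq enum_val_inj).
rewrite !inE; case: (boolP (enum_val i \in S)) => iS;
  case: (boolP (_ \in S)) => jS.
(* The value k - 1 is the number of common neighbours only if S has at least
   two vertices; for k = 0 there is no off-diagonal entry inside S. *)
- rewrite (card_common_neighbours_clique cliqueS) // cardS subSS mulr1n.
  case: k cardS {cardI} => [/eqP/cards1P[x defS]|k _];
    last by rewrite subn1 mulrSr addrK.
  by move: iS jS uv; rewrite defS !inE => /eqP-> /eqP->; rewrite eqxx.
all: rewrite mulr0n; apply/eqP; rewrite pnatr_eq0 cards_eq0 -subset0.
all: apply/subsetP => w; rewrite !inE => /and4P[wi wj].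
all: case: (boolP (w \in S)) => wS.
- by rewrite (negPf (isoS _ wS _ jS)).
- by rewrite [adj w _]adj_sym (negPf (isoS _ iS _ wS)).
- by rewrite (negPf (isoS _ wS _ iS)).
- by move=> _; rewrite [adj w _]adj_sym (negPf (isoS _ jS _ wS)).
- by rewrite (negPf (isoS _ wS _ iS)).
(* Otherwise w, enum_val i and enum_val j are three vertices outside S. *)
have: [set w; enum_val i; enum_val j] \subset ~: S.
  by apply/subsetP => z; rewrite !inE => /orP[/orP[]|] /eqP->.
move/subset_leq_card; rewrite -setUA cardsU1 cards2 !inE negb_or wi wj uv.
by move/leq_trans/(_ cardCS).
Qed.

(** * Groups with an abelian half inverted by its complement *)

Section AbelianHalf.

Local Open Scope group_scope.

(** Dihedral and dicyclic groups both have this form; they differ in the squares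
    of the elements outside H, which influence neither the centre nor the sizes
    of the classes. *)
Definition inverted_half (gT : finGroupType) (G H : {group gT}) : Prop :=
  [/\ H \subset G, abelian H, #|G : H| = 2
    & {in G :\: H & H, forall g h, h ^ g = h^-1}].

Section InvertedHalf.

Variables (gT : finGroupType) (G H : {group gT}).

Lemma inverted_half_card : inverted_half G H -> #|G| = (2 * #|H|)%N.
Proof. by case=> sHG _ iGH _; rewrite -(Lagrange sHG) iGH mulnC. Qed.

Lemma inverted_half_normal : inverted_half G H -> H <| G.
Proof. by case=> sHG _ iGH _; apply: index2_normal. Qed.

Lemma inverted_half_outer : inverted_half G H -> exists g, g \in G :\: H.
Proof.
case=> _ _ iGH _; apply/set0Pn; rewrite setD_eq0 -indexg_eq1.
by rewrite iGH.
Qed.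

(** For g outside H, an element h of H commutes with g iff h = h ^ g = h^-1. *)
Lemma cent1_outer_cap : inverted_half G H ->
  {in G :\: H, forall g, 'C_G[g] :&: H = 'Ldiv_2(H)}.
Proof.
case=> sHG _ _ invH g gGH; apply/setP=> h; rewrite !in_setI andbC.
case: (boolP (h \in H)) => //= hH; rewrite (subsetP sHG) //= [in RHS]inE.
by rewrite (sameP cent1P commgP) (sameP conjg_fixP eqP) invH // eq_invg_mul.
Qed.

(** The subgroup H is maximal and g is in its own centraliser, so
    H * 'C_G[g] = G; the product formula then gives the order of 'C_G[g] from
    its intersection with H. *)
Lemma card_outer_class : inverted_half G H ->
  {in G :\: H, forall g, (#|g ^: G| * #|'Ldiv_2(H)|)%N = #|H|}.
Proof.
move=> GH g gGH; have [sHG _ iGH invH] := GH.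
have [gG gH] := setDP gGH.
have CH : H * 'C_G[g] = G.
  apply: mulg_normal_maximal; rewrite ?inverted_half_normal ?subsetIl //.
    by apply: p_index_maximal; rewrite ?iGH.
  by apply: contra gH => /subsetP; apply; rewrite inE gG cent1id.
have CC : (0 < #|'C_G[g]|)%N by [].
apply/eqP; rewrite -(eqn_pmul2r CC) mulnAC -index_cent1 mulnC.
rewrite [(#|G : _| * _)%N]mulnC Lagrange ?subsetIl // mul_cardG CH.
by rewrite -(cent1_outer_cap GH gGH) setIC mulnC.
Qed.

Lemma inner_class : inverted_half G H ->
  {in H, forall h, h ^: G = [set h; h^-1]}.
Proof.
move=> GH h hH; have [sHG abH _ invH] := GH.
have [g gGH] := inverted_half_outer GH; have [gG _] := setDP gGH.
apply/eqP; rewrite eqEsubset; apply/andP; split; last first.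
  apply/subsetP=> z; rewrite !inE => /orP[]/eqP->; first exact: class_refl.
  by rewrite -(invH g h) // memJ_class.
apply/subsetP=> _ /imsetP[z zG ->]; rewrite !inE.
have [zH|zH] := boolP (z \in H).
  by rewrite (conjg_fixP _) ?eqxx //; apply/commgP/(centsP abH).
by rewrite invH ?eqxx ?orbT // inE zH.
Qed.

(** An element outside H inverts H, so it is central only if every element of H
    is its own inverse, which the hypothesis excludes. *)
Lemma inverted_half_center : inverted_half G H -> ~~ (H \subset 'Ldiv_2()) ->
  'Z(G) = 'Ldiv_2(H).
Proof.
move=> GH /subsetPn[h hH]; rewrite inE => h2; have [sHG abH _ invH] := GH.
have [g gGH] := inverted_half_outer GH; have [gG _] := setDP gGH.
apply/setP=> z; rewrite [in RHS]inE; apply/idP/andP => [zZ|[zH]].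
  have [zG cz] := setIP zZ; have zH: z \in H.
    apply: contraR h2 => zH; rewrite expgS -eq_invg_mul -(invH z h) ?inE ?zH //.
    by apply/eqP/conjg_fixP/commgP/commute_sym/(centP cz)/(subsetP sHG).
  suff: z \in 'Ldiv_2(H) by case/setIP.
  rewrite -(cent1_outer_cap GH gGH) !in_setI zH zG andbT /=.
  by apply/cent1P/(centP cz).
rewrite inE expgS -eq_invg_mul => z2.
have zG := subsetP sHG _ zH; rewrite inE zG; apply/centP=> y yG.
have: z ^ y \in z ^: G by rewrite memJ_class.
rewrite inner_class // (eqP z2) setUid inE => /eqP/conjg_fixP/commgP.
exact.
Qed.

End InvertedHalf.

Lemma card_classes_uniform (gT : finGroupType) (G : {group gT}) (A : {set gT})
    (k : nat) :
    G \subset 'N(A) -> {in A, forall a, #|a ^: G| = k} ->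
  (#|[set a ^: G | a in A]| * k)%N = #|A|.
Proof.
move=> nAG cardA; apply/esym/card_uniform_partition.
  by move=> _ /imsetP[a aA ->]; apply: cardA.
by apply: orbit_partition; rewrite /= astabsJ.
Qed.

(** The 2k + 2 non-central elements of H lie in classes of size 2, and the
    2k + 4 elements outside H lie in classes of size k + 2. *)
Lemma inverted_half_classes (gT : finGroupType) (G H : {group gT}) (k : nat) :
    inverted_half G H -> #|'Ldiv_2(H)| = 2%N -> #|H| = (2 * k.+2)%N ->
  let S := [set C : ccc_graph G | val C \subset H] in
  [/\ #|S| = k.+1, #|~: S| = 2,
    {in S &, forall C D, adj C D = (C != D)}
  & {in S, forall C D, D \notin S -> ~~ adj C D}].
Proof.
move=> GH L2 cardH S; have [sHG abH iGH invH] := GH.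
have nHG := normal_norm (inverted_half_normal GH).
have sHL : ~~ (H \subset 'Ldiv_2()).
  apply: contra_eqN cardH => /setIidPl HL.
  by rewrite -HL L2 mulnS.
have Zdef := inverted_half_center GH sHL.
have sZH : 'Z(G) \subset H by rewrite Zdef subsetIl.
have vS C : C \in S -> exists2 h, h \in H :\: 'Z(G) & val C = h ^: G.
  rewrite inE; case/imsetP: (valP C) => h /setDP[hG hZ] Ch.
  rewrite Ch class_sub_norm // => hH.
  by exists h; rewrite // inE hZ.
have vCS C : C \notin S -> exists2 g, g \in G :\: H & val C = g ^: G.
  rewrite inE; case/imsetP: (valP C) => h /setDP[hG hZ] Ch.
  rewrite Ch class_sub_norm // => hH.
  by exists h; rewrite // inE hH.
have valS : [set val C | C in S] = [set h ^: G | h in H :\: 'Z(G)].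
  apply/setP=> A; apply/imsetP/imsetP => [[C CS ->]|[h hHZ ->]].
    by have [h ? ->] := vS C CS; exists h.
  have [hH hZ] := setDP hHZ.
  have hV : h ^: G \in noncentral_classes G.
    by apply: imset_f; rewrite inE hZ (subsetP sHG).
  by exists (exist [in noncentral_classes G] _ hV : ccc_graph G);
    rewrite ?inE /= ?class_sub_norm.
have valCS : [set val C | C in ~: S] = [set g ^: G | g in G :\: H].
  apply/setP=> A; apply/imsetP/imsetP => [[C CS ->]|[g gGH ->]].
    by have [|g ? ->] := vCS C; [rewrite inE in CS|exists g].
  have [gG gH] := setDP gGH.
  have gV : g ^: G \in noncentral_classes G.
    by apply: imset_f; rewrite inE gG (contra _ gH) // => /(subsetP sZH).
  by exists (exist [in noncentral_classes G] _ gV : ccc_graph G);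
    rewrite ?inE /= ?class_sub_norm.
split.
- rewrite -(card_imset _ val_inj) valS; apply/eqP.
  rewrite -(eqn_pmul2r (isT : (0 < 2)%N)) (card_classes_uniform (k := 2)).
  + by rewrite cardsD (setIidPr sZH) Zdef L2 cardH mulnS addKn mulnC.
  + by rewrite normsD // gFnorm_trans.
  move=> h /setDP[hH]; rewrite Zdef inE hH inE expgS -eq_invg_mul /=.
  by rewrite expg1 (inner_class GH hH) cards2 [h == _]eq_sym => /negPf->.
- rewrite -(card_imset _ val_inj) valCS; apply/eqP.
  have Hk : (#|H| = k.+2 * 2)%N by rewrite cardH mulnC.
  rewrite -(eqn_pmul2r (isT : (0 < k.+2)%N)) (card_classes_uniform (k := k.+2)).
  + rewrite cardsD (setIidPr sHG) (inverted_half_card GH) mul2n.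
    by rewrite -addnn addnK cardH.
  + by rewrite normsD // normG.
  move=> g gGH; apply/eqP; rewrite -(eqn_pmul2r (isT : (0 < 2)%N)) -Hk.
  by rewrite -(card_outer_class GH gGH) L2.
- move=> C D CS DS; rewrite /adj /= /ccc_adj; case: eqP => //= _.
  have [h /setDP[hH _] ->] := vS C CS; have [l /setDP[lH _] ->] := vS D DS.
  apply/exists_inP; exists h; rewrite ?class_refl //.
  apply/exists_inP; exists l; rewrite ?class_refl //.
  by apply/eqP/(centsP abH).
move=> C CS D DS; rewrite /adj /= /ccc_adj negb_and; apply/orP; right.
apply/exists_inP => -[a aC /exists_inP[b bD /eqP ab]].
have [h hHZ Ch] := vS C CS; have [g gGH Dg] := vCS D DS.
have aHZ : a \in H :\: 'Z(G).
  apply: subsetP aC; rewrite Ch class_sub_norm //.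
  by rewrite normsD // gFnorm_trans.
have bGH : b \in G :\: H.
  apply: subsetP bD; rewrite Dg class_sub_norm //.
  by rewrite normsD // normG.
have [aH /negP[]] := setDP aHZ.
rewrite Zdef -(cent1_outer_cap GH bGH) !in_setI aH (subsetP sHG) //= andbT.
by apply/cent1P.
Qed.

End AbelianHalf.

(** * A group of order 4n satisfying the dicyclic relations *)

Section DicyclicModel.

Variable n : nat.

Local Notation point := ('Z_(2 * n) * bool)%type.

(** The pair (i, b) stands for x^i y^b.  Multiplying on the right by x uses
    y x = x^-1 y, and by y uses y^2 = x^n. *)
Definition mulx_fun (p : point) : point :=
  (if p.2 then p.1 - 1 else p.1 + 1, p.2).

Definition muly_fun (p : point) : point :=
  (if p.2 then p.1 + n%:R else p.1, ~~ p.2).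

Fact mulx_fun_inj : injective mulx_fun.
Proof. by rewrite /mulx_fun => -[i []] [j []] //= /(congr1 fst) /addIr ->. Qed.

Fact muly_fun_inj : injective muly_fun.
Proof.
rewrite /muly_fun => -[i []] [j []] //= /(congr1 fst); first by move/addIr->.
by move=> /= ->.
Qed.

Definition mulx : {perm point} := perm mulx_fun_inj.
Definition muly : {perm point} := perm muly_fun_inj.

Lemma mulxX k (p : point) :
  (mulx ^+ k)%g p = (if p.2 then p.1 - k%:R else p.1 + k%:R, p.2).
Proof.
elim: k p => [|k IH] [i b] /=.
  by rewrite expg0 perm1 subr0 addr0; case: b.
rewrite expgSr permM IH permE /mulx_fun /= mulrSr.
by case: b; congr (_, _); ring.
Qed.

Lemma muly_sq (p : point) : (muly ^+ 2)%g p = (p.1 + n%:R, p.2).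
Proof. by case: p => i [] /=; rewrite permM !permE. Qed.

Lemma dicyclic_model_homg : (1 < n)%N ->
  ((<[mulx]> <*> <[muly]>)%G \homg Grp (x : y :
       x ^+ (2 * n) = 1, x ^+ n = y ^+ 2, y^-1 * x * y = x^-1))%g.
Proof.
move=> n_gt1.
have double_n0 : (2 * n)%:R = 0 :> 'Z_(2 * n).
  by rewrite pchar_Zp // (leq_trans n_gt1) // leq_pmull.
have addnn0 : n%:R + n%:R = 0 :> 'Z_(2 * n) by rewrite -natrD addnn -mul2n.
apply/existsP; exists (mulx, muly); rewrite /= !xpair_eqE eqxx /=.
have subn_addn (i : 'Z_(2 * n)) : i - n%:R = i + n%:R.
  by apply/eqP; rewrite subr_eq -addrA addnn0 addr0.
apply/and3P; split; apply/eqP.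
- by apply/permP=> -[i []]; rewrite mulxX perm1 double_n0 ?subr0 ?addr0.
- by apply/permP=> -[i []]; rewrite mulxX muly_sq ?subn_addn.
(* The last relation is checked as x y x = y, which involves no inverse. *)
apply: (mulIg mulx); rewrite mulVg -!mulgA; apply: (mulgI muly).
rewrite mulKVg mulg1; apply/permP=> -[i []]; rewrite !permM !permE /=.
all: by rewrite /mulx_fun /muly_fun /=; congr (_, _); ring.
Qed.

(** The element x^i y^b sends (0, false) to (i, b), so the action is transitive
    on 4n points. *)
Lemma dicyclic_model_card :
  (1 < n)%N -> (4 * n <= #|(<[mulx]> <*> <[muly]>)%g|)%N.
Proof.
move=> n_gt1; have cardT : #|[set: point]| = (4 * n)%N.
  rewrite cardsT card_prod card_bool card_ord Zp_cast; first by ring.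
  by rewrite (leq_trans n_gt1) // leq_pmull.
pose f (s : {perm point}) := s (0, false).
have /subset_leq_card : [set: point] \subset f @: (<[mulx]> <*> <[muly]>)%g.
  apply/subsetP=> -[i b] _; apply/imsetP.
  exists (mulx ^+ i * muly ^+ b)%g.
    by rewrite groupM // groupX // mem_gen // inE cycle_id ?orbT.
  rewrite /f permM mulxX natr_Zp.
  by case: b; rewrite /= ?expg1 ?expg0 ?perm1 ?permE /muly_fun /= add0r.
by rewrite -cardT => /leq_trans; apply; apply: leq_imset_card.
Qed.

End DicyclicModel.

(** * The cyclic half of a dicyclic group *)

Section DicyclicGroup.

Local Open Scope group_scope.

(** The relations bound both #|<x>| and the index of <x>, with product at most
    4n; since #|G| >= 4n by comparison with the model, both are attained. *)
Lemma dicyclic_inverted_half (n : nat) (gT : finGroupType) (G : {group gT}) :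
    (1 < n)%N ->
    (G \isog Grp (x : y :
       x ^+ (2 * n) = 1, x ^+ n = y ^+ 2, y^-1 * x * y = x^-1)) ->
  exists H : {group gT},
    [/\ inverted_half G H, #|H| = (2 * n)%N & #|'Ldiv_2(H)| = 2].
Proof.
move=> n1 isoG.
have cardG : (4 * n <= #|G|)%N.
  apply: leq_trans (dicyclic_model_card n1) (leq_homg _).
  by rewrite isoG dicyclic_model_homg.
have /existsP[[x y]] := isoGrp_hom isoG; rewrite /= !xpair_eqE /=.
case/and4P=> /eqP defG /eqP x2n /eqP xn /eqP yxy.
pose H := <[x]>%G.
have xy : x ^ y = x^-1 by rewrite conjgE mulgA.
have nHy : y \in 'N(H) by rewrite inE -cycleJ xy cycleV.
have y2H : y ^+ 2 \in H by rewrite -xn groupX ?cycle_id.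
have sHG : H \subset G by rewrite -defG joing_subl.
have n0 : (0 < n)%N by apply: ltnW.
have cardH_le : (#|H| <= 2 * n)%N.
  by rewrite dvdn_leq ?muln_gt0 // order_dvdn x2n.
have GHy : G :=: H * <[y]>.
  by rewrite -defG norm_joinEr // cycle_subG.
have nHG : G \subset 'N(H).
  by rewrite GHy mul_subG ?normG // cycle_subG.
have iGH_le : (#|G : H| <= 2)%N.
  rewrite -card_quotient // GHy quotientMidl quotient_cycle //.
  by rewrite dvdn_leq // order_dvdn -morphX //= coset_id.
have LGH := Lagrange sHG.
have cardH : #|H| = (2 * n)%N.
  apply/eqP; rewrite eqn_leq cardH_le /= -(leq_pmul2r (isT : (0 < 2)%N)).
  by rewrite mulnAC (leq_trans cardG) // -LGH leq_mul2l iGH_le orbT.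
have iGH : #|G : H| = 2.
  apply/eqP; rewrite eqn_leq iGH_le /= -(@leq_pmul2l (2 * n)%N) ?muln_gt0 //.
  by rewrite mulnAC (leq_trans cardG) // -LGH cardH.
have invH : {in G :\: H & H, forall g h, h ^ g = h^-1}.
  move=> g h /setDP[]; rewrite GHy => /mulsgP[a _ aH /cycleP[j ->] ->].
  rewrite -(odd_double_half j) -mul2n addnC expgD expgM mulgA.
  (* Odd powers of y are left: g is an element of H, which centralises H,
     times y. *)
  have bH : a * (y ^+ 2) ^+ j./2 \in H by rewrite groupM 1?groupX.
  case: (odd j) => [_ hH | /negP[]]; last by rewrite expg0 mulg1.
  have chb : h ^ (a * (y ^+ 2) ^+ j./2) = h.
    by apply/conjg_fixP/commgP/(centsP (cycle_abelian x)).
  rewrite conjgM chb expg1; case/cycleP: hH => i ->.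
  by rewrite conjXg xy expgVn.
exists H; split=> //; first by split; rewrite ?cycle_abelian.
have x_order : #[x] = (2 * n)%N by [].
have -> : 'Ldiv_2(H) = [set 1; x ^+ n].
  apply/setP=> z; rewrite !inE; apply/andP/orP => [[/cyclePmin[i]]|].
    rewrite x_order => i2n ->.
    rewrite -expgM -order_dvdn x_order [(i * 2)%N]mulnC.
    rewrite dvdn_pmul2l // => /dvdnP[[|[|k]] def_i].
    - by left; rewrite def_i.
    - by right; rewrite def_i mul1n.
    by move: i2n; rewrite def_i ltn_pmul2r.
  case=> /eqP->; rewrite ?group1 ?expg1n ?eqxx //.
  by rewrite groupX ?cycle_id // -expgM mulnC x2n.
by rewrite cards2 eq_sym -order_dvdn x_order gtnNdvd // ltn_Pmull.
Qed.

End DicyclicGroup.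

(** * The spectrum and the energy *)

Theorem theorem2p3 (n : nat) (hn : (2 <= n)%N)
    (gT : finGroupType) (T4n : {group gT})
    (hT4n : (T4n \isog Grp (x : y :
       x ^+ (2 * n) = 1, x ^+ n = y ^+ 2, y^-1 * x * y = x^-1))%g) :
  perm_eq (CN_spec (ccc_graph T4n))
    (nseq (n - 2) (- (n%:R - 3))
       ++ nseq 1 ((n%:R - 2) * (n%:R - 3)) ++ nseq 2 0)
  /\ CN_energy (ccc_graph T4n) = 2 * (n%:R - 2) * (n%:R - 3).
Proof.
case: n hn hT4n => [|[|k]] // _ isoT.
have [H [TH cardH L2]] := dicyclic_inverted_half (isT : (1 < k.+2)%N) isoT.
have [cardS cardCS cliqueS isoS] := inverted_half_classes TH L2 cardH.
have two_more : k.+2%:R = k%:R + 2 :> algC by rewrite -addn2 natrD.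
have := CN_spec_isolated_clique cardS (eq_leq cardCS) cliqueS isoS.
rewrite cardCS subSS subSS subn0 two_more.
have -> : k%:R + 2 - 3 = k%:R - 1 :> algC by ring.
have -> : k%:R + 2 - 2 = k%:R :> algC by ring.
rewrite opprB => spec; split; first exact: spec.
rewrite /CN_energy (perm_big _ spec) /= big_cat /= !big_cons big_nil big_nseq.
rewrite iter_addr_0 -[_ *+ k in LHS]mulr_natl normr0 !addr0 distrC normrM.
rewrite normr_nat.
suff -> : k%:R * `|k%:R - 1| = k%:R * (k%:R - 1) :> algC by ring.
(* Only for k = 0 is k - 1 negative, and then both sides vanish. *)
case: k {isoT cardH cardS two_more spec} => [|k]; first by rewrite !mul0r.
by rewrite mulrSr addrK normr_nat.
Qed.
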